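(* Let $T$ be a connected strongly graded $S$-ring and $P\subseteq T$ an $S$-subbimodule. For $n\in\mathbb N$ put $P_n:=\sum_{i+j+k=n}T^{\le i}\cdot P^{\le j}\cdot T^{\le k}$. The following assertions are equivalent: (1) The bimodule $P$ is of PBW-type. (2) The filtration $\{P_n\}_{n\in\mathbb N}$ is jacobian, that is, $P$ satisfies the Jacobi condition $P_{n+1}\cap T^{\le n}\subseteq P_n$ for all $n\in\mathbb N$. (3) $P_m\cap T^{\le n}\subseteq P_n$ for all $n\in\mathbb N$ and $m>n$. (4) $\langle P\rangle\cap T^{\le n}=P_n$ for all $n\in\mathbb N$.
   Context: $S$ is an associative unital ring. A positively graded $S$-ring $T=\bigoplus_{n\ge0}T^n$ is connected if $T^0=S$ and strongly graded if $T^nT^m=T^{n+m}$ for all $n,m$. Let $p^n:T\to T^n$ be the projection, $T^{\le n}=\bigoplus_{m\le n}T^m$, $X^{\le n}=X\cap T^{\le n}$, and $\langle X\rangle$ the two-sided ideal generated by $X$. For an $S$-subbimodule $P\subseteq T$: $R_P^n:=p^n(P^{\le n})$, $R_P:=\bigoplus_nR_P^n$; $A(R_P):=T/\langle R_P\rangle$; $U(P):=T/\langle P\rangle$, filtered by $U(P)^{\le n}$ = image of $T^{\le n}$. There is a surjective graded $S$-ring morphism $\Phi_P:A(R_P)\to\operatorname{gr}U(P)$ given for $x\in T^n$ by $x+\langle R_P\rangle\mapsto(x+\langle P\rangle)+U(P)^{\le n-1}$. $P$ is of PBW-type if $\Phi_P$ is an isomorphism. *)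

(* Defs.v *)
From HB Require Import structures.
From mathcomp Require Import all_boot all_algebra.
From mathcomp Require Import boolp classical_sets.

Set Implicit Arguments.
Unset Strict Implicit.
Unset Printing Implicit Defensive.

Import GRing.Theory.
Local Open Scope ring_scope.
Local Open Scope classical_set_scope.
Local Open Scope quotient_scope.

Definition zmod_set (V : zmodType) (A : set V) : Prop :=
  A 0 /\ forall x y, A x -> A y -> A (x - y).

Definition zspan (V : zmodType) (A : set V) : set V := smallest (@zmod_set V) A.

(* Product of additive subgroups: finite sums of products a * b. *)
Definition mulset (R : pzRingType) (A B : set R) : set R :=
  zspan [set a * b | a in A & b in B].

Definition ideal_set (R : pzRingType) (I : set R) : Prop :=
  zmod_set I /\ forall a x, I x -> I (a * x) /\ I (x * a).

Definition ideal_gen (R : pzRingType) (X : set R) : set R :=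
  smallest (@ideal_set R) X.

Section ZmodSet.
Variables (V : zmodType) (A : set V).
Hypothesis zA : zmod_set A.

Lemma zmod_setN x : A x -> A (- x).
Proof. by move=> Ax; rewrite -[- x]add0r; apply: zA.2 => //; exact: zA.1. Qed.

Lemma zmod_setD x y : A x -> A y -> A (x + y).
Proof. by move=> Ax Ay; rewrite -[y]opprK; apply: zA.2 => //; exact: zmod_setN. Qed.

Lemma zmod_set_sum (I : Type) (r : seq I) (Q : pred I) (f : I -> V) :
  (forall i, Q i -> A (f i)) -> A (\sum_(i <- r | Q i) f i).
Proof. by move=> h; elim/big_ind: _ => //; [exact: zA.1|exact: zmod_setD]. Qed.

End ZmodSet.

Lemma zspan_zmod (V : zmodType) (A : set V) : zmod_set (zspan A).
Proof.
split=> [|x y Ax Ay] B [zB AB]; first exact: zB.1.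
by apply: zB.2; [apply: Ax|apply: Ay].
Qed.

Lemma ideal_gen_ideal (R : pzRingType) (X : set R) : ideal_set (ideal_gen X).
Proof.
split; first split=> [|x y Ix Iy] B [iB XB]; first exact: iB.1.1.
  by apply: iB.1.2; [apply: Ix|apply: Iy].
by move=> a x Ix; split=> B [iB XB]; have [] := iB.2 a x (Ix B (conj iB XB)).
Qed.

(* Quotient of a ring by the two-sided ideal generated by a subset: the
   library puts a ring structure on quotients of commutative rings only. *)

Definition ideal_pred (R : pzRingType) (X : set R) : {pred R} :=
  fun x => `[< ideal_gen X x >].

Lemma ideal_predP (R : pzRingType) (X : set R) x :
  reflect (ideal_gen X x) (x \in ideal_pred X).
Proof. exact: asboolP. Qed.

Fact ideal_pred_zmod (R : pzRingType) (X : set R) : zmod_closed (ideal_pred X).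
Proof.
have [zI _] := ideal_gen_ideal X; split; first by apply/ideal_predP; exact: zI.1.
by move=> x y /ideal_predP Ix /ideal_predP Iy; apply/ideal_predP; exact: zI.2.
Qed.
HB.instance Definition _ (R : pzRingType) (X : set R) :=
  GRing.isZmodClosed.Build R (ideal_pred X) (ideal_pred_zmod X).

Definition quot_ring (R : pzRingType) (X : set R) : Type :=
  Quotient.quot (ideal_pred X).

Section QuotRing.
Variables (R : pzRingType) (X : set R).
Local Notation Q := (quot_ring X).

HB.instance Definition _ := GRing.Zmodule.on Q.

Definition qproj (x : R) : Q := \pi_(Quotient.quot (ideal_pred X)) x.
Definition qrepr (q : Q) : R := repr (q : Quotient.quot (ideal_pred X)).

Lemma qreprK : cancel qrepr qproj. Proof. exact: reprK. Qed.

Lemma qproj_eq x y : qproj x = qproj y <-> ideal_gen X (x - y).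
Proof.
split=> [/eqP|I]; last by apply/eqP; rewrite -Quotient.idealrBE; exact/ideal_predP.
by rewrite -Quotient.idealrBE => /ideal_predP.
Qed.

Fact qproj_zmod : zmod_morphism qproj.
Proof. by move=> x y; rewrite /qproj raddfB. Qed.
HB.instance Definition _ := GRing.isZmodMorphism.Build R Q qproj qproj_zmod.

Definition qone : Q := qproj 1.
Definition qmul (a b : Q) : Q := qproj (qrepr a * qrepr b).

Lemma qmulE x y : qmul (qproj x) (qproj y) = qproj (x * y).
Proof.
have [zI mI] := ideal_gen_ideal X; apply/qproj_eq.
set x' := qrepr _; set y' := qrepr _.
have -> : x' * y' - x * y = (x' - x) * y' + x * (y' - y).
  by rewrite mulrBl mulrBr addrA subrK.
have hx : ideal_gen X (x' - x) by apply/qproj_eq; rewrite qreprK.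
have hy : ideal_gen X (y' - y) by apply/qproj_eq; rewrite qreprK.
exact: (zmod_setD zI (mI y' _ hx).2 (mI x _ hy).1).
Qed.

Fact qmulA : associative qmul.
Proof.
by move=> a b c; rewrite -[a]qreprK -[b]qreprK -[c]qreprK !qmulE mulrA.
Qed.
Fact qmul1 : left_id qone qmul.
Proof. by move=> a; rewrite -[a]qreprK qmulE mul1r. Qed.
Fact qmulr1 : right_id qone qmul.
Proof. by move=> a; rewrite -[a]qreprK qmulE mulr1. Qed.
Fact qmulDl : left_distributive qmul +%R.
Proof.
move=> a b c; rewrite -[a]qreprK -[b]qreprK -[c]qreprK.
by rewrite -raddfD /= !qmulE -raddfD mulrDl.
Qed.
Fact qmulDr : right_distributive qmul +%R.
Proof.
move=> a b c; rewrite -[a]qreprK -[b]qreprK -[c]qreprK.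
by rewrite -raddfD /= !qmulE -raddfD mulrDr.
Qed.
HB.instance Definition _ := GRing.Zmodule_isPzRing.Build Q
  qmulA qmul1 qmulr1 qmulDl qmulDr.

Fact qproj_monoid : monoid_morphism qproj.
Proof. by split=> // x y; rewrite -qmulE. Qed.
HB.instance Definition _ := GRing.isMonoidMorphism.Build R Q qproj qproj_monoid.

End QuotRing.

Record filtration (U : pzRingType) := Filtration {
  fil :> nat -> set U;
  fil_zmod : forall n, zmod_set (fil n);
  fil_mono : forall n, fil n `<=` fil n.+1;
  fil1 : fil 0 1;
  filM : forall m n x y, fil m x -> fil n y -> fil (m + n) (x * y)
}.

Section AssociatedGraded.
Variables (U : pzRingType) (F : filtration U).

(* The term of index n - 1 of the filtration, with the term of index -1 zero. *)
Definition fil_pred (n : nat) : set U :=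
  if n is n'.+1 then F n' else [set 0].

Definition fil_predb (n : nat) : {pred U} := fun x => `[< fil_pred n x >].

Lemma fil_predbP n x : reflect (fil_pred n x) (x \in fil_predb n).
Proof. exact: asboolP. Qed.

Lemma fil_pred_zmod n : zmod_set (fil_pred n).
Proof.
case: n => [|n]; last exact: fil_zmod.
by split=> // x y /= -> ->; rewrite subr0.
Qed.

Fact fil_predb_zmod n : zmod_closed (fil_predb n).
Proof.
have z := fil_pred_zmod n; split; first by apply/fil_predbP; exact: z.1.
by move=> x y /fil_predbP Ix /fil_predbP Iy; apply/fil_predbP; exact: z.2.
Qed.
HB.instance Definition _ n :=
  GRing.isZmodClosed.Build U (fil_predb n) (fil_predb_zmod n).

(* U modulo the preceding term; the graded piece of degree n is the image of
   F n in it. *)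
Definition gr_amb (n : nat) : Type := Quotient.quot (fil_predb n).
HB.instance Definition _ n := GRing.Zmodule.on (gr_amb n).

Definition gr_cls (n : nat) (u : U) : gr_amb n :=
  \pi_(Quotient.quot (fil_predb n)) u.

Fact gr_cls_zmod n : zmod_morphism (gr_cls n).
Proof. by move=> x y; rewrite /gr_cls raddfB. Qed.
HB.instance Definition _ n :=
  GRing.isZmodMorphism.Build U (gr_amb n) (gr_cls n) (gr_cls_zmod n).

Lemma gr_cls_eq n x y : gr_cls n x = gr_cls n y <-> fil_pred n (x - y).
Proof.
split=> [/eqP|I]; last by apply/eqP; rewrite -Quotient.idealrBE; exact/fil_predbP.
by rewrite -Quotient.idealrBE => /fil_predbP.
Qed.

Lemma gr_cls_eq0 n x : gr_cls n x = 0 <-> fil_pred n x.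
Proof. by rewrite -(raddf0 (gr_cls n)) gr_cls_eq subr0. Qed.

Definition gr_piece (n : nat) : set (gr_amb n) := gr_cls n @` F n.

(* The external direct sum of the graded pieces. *)
Record gr : Type := Gr {
  gr_coef : forall n, gr_amb n;
  gr_coefP : forall n, gr_piece (gr_coef n);
  gr_fin : exists N, forall n, (N <= n)%N -> gr_coef n = 0
}.

HB.instance Definition _ := gen_eqMixin gr.
HB.instance Definition _ := gen_choiceMixin gr.

Lemma grP (f g : gr) : (forall n, gr_coef f n = gr_coef g n) -> f = g.
Proof.
case: f g => [f f1 f2] [g g1 g2] /= fg.
have {}fg : f = g by apply: functional_extensionality_dep.
by subst g; congr Gr; exact: Prop_irrelevance.
Qed.

Lemma gr_piece_zmod n : zmod_set (@gr_piece n).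
Proof.
have z := fil_zmod F n; split; first by exists 0; [exact: z.1|rewrite raddf0].
by move=> _ _ [x Fx <-] [y Fy <-]; exists (x - y); [exact: z.2|rewrite raddfB].
Qed.

Fact gr0_P n : gr_piece (0 : gr_amb n). Proof. exact: (gr_piece_zmod n).1. Qed.
Fact gr0_fin : exists N, forall n, (N <= n)%N -> (0 : gr_amb n) = 0.
Proof. by exists 0. Qed.
Definition gr_zero : gr := Gr gr0_P gr0_fin.

Section Opp.
Variable f : gr.
Fact grN_P n : gr_piece (- gr_coef f n).
Proof. exact: (zmod_setN (gr_piece_zmod n) (gr_coefP f n)). Qed.
Fact grN_fin : exists N, forall n, (N <= n)%N -> - gr_coef f n = 0.
Proof. by have [N h] := gr_fin f; exists N => n /h ->; rewrite oppr0. Qed.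
Definition gr_opp : gr := Gr grN_P grN_fin.
End Opp.

Section Add.
Variables f g : gr.
Fact grD_P n : gr_piece (gr_coef f n + gr_coef g n).
Proof. exact: (zmod_setD (gr_piece_zmod n) (gr_coefP f n) (gr_coefP g n)). Qed.
Fact grD_fin : exists N, forall n, (N <= n)%N -> gr_coef f n + gr_coef g n = 0.
Proof.
have [N h] := gr_fin f; have [M k] := gr_fin g; exists (maxn N M) => n.
by rewrite geq_max => /andP[/h -> /k ->]; rewrite addr0.
Qed.
Definition gr_add : gr := Gr grD_P grD_fin.
End Add.

Fact gr_addA : associative gr_add.
Proof. by move=> f g h; apply: grP => n /=; rewrite addrA. Qed.
Fact gr_addC : commutative gr_add.
Proof. by move=> f g; apply: grP => n /=; rewrite addrC. Qed.
Fact gr_add0 : left_id gr_zero gr_add.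
Proof. by move=> f; apply: grP => n /=; rewrite add0r. Qed.
Fact gr_addN : left_inverse gr_zero gr_opp gr_add.
Proof. by move=> f; apply: grP => n /=; rewrite addNr. Qed.
HB.instance Definition _ := GRing.isZmodule.Build gr
  gr_addA gr_addC gr_add0 gr_addN.

Definition gr_rep (f : gr) (n : nat) : U :=
  xget 0 [set x | F n x /\ gr_cls n x = gr_coef f n].

Lemma gr_repP f n : F n (gr_rep f n) /\ gr_cls n (gr_rep f n) = gr_coef f n.
Proof.
have [x Fx e] := gr_coefP f n.
by apply: (@xgetPex _ 0 [set x | F n x /\ gr_cls n x = gr_coef f n]); exists x.
Qed.

Lemma fil_predMl m n x y : fil_pred m x -> F n y -> fil_pred (m + n) (x * y).
Proof.
case: m => [|m] Fx Fy; last exact: filM.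
have -> : x = 0 by [].
by rewrite mul0r; have [] := fil_pred_zmod (0 + n).
Qed.

Lemma fil_predMr m n x y : F m x -> fil_pred n y -> fil_pred (m + n) (x * y).
Proof.
case: n => [|n] Fx Fy; last by rewrite addnS; exact: filM.
have -> : y = 0 by [].
by rewrite mulr0; have [] := fil_pred_zmod (m + 0).
Qed.

Definition cauchy (a b : nat -> U) (n : nat) : U :=
  \sum_(i < n.+1) a i * b (n - i)%N.

Lemma cauchy_rev a b n : cauchy a b n = \sum_(i < n.+1) a (n - i)%N * b i.
Proof.
rewrite /cauchy (reindex_inj rev_ord_inj) /=.
by apply: eq_bigr => i _; rewrite subSS subKn // -ltnS.
Qed.

Lemma cauchyA a b c n : cauchy a (cauchy b c) n = cauchy (cauchy a b) c n.
Proof.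
rewrite [RHS]cauchy_rev {1}/cauchy.
pose coef3 j k := a j * (b (n - j - k)%N * c k).
transitivity (\sum_(j < n.+1) \sum_(k < n.+1 | (k <= n - j)%N) coef3 j k).
  apply: eq_bigr => /= j _; rewrite cauchy_rev big_distrr /=.
  by rewrite (big_ord_narrow_leq (leq_subr _ _)).
rewrite (exchange_big_dep predT) //=; apply: eq_bigr => k _.
transitivity (\sum_(j < n.+1 | (j <= n - k)%N) coef3 j k).
  apply: eq_bigl => j; rewrite -ltnS -(ltnS j) -!subSn ?leq_ord //.
  by rewrite -subn_gt0 -(subn_gt0 j) -!subnDA addnC.
rewrite (big_ord_narrow_leq (leq_subr _ _)) /cauchy big_distrl /=.
by apply: eq_bigr => j _; rewrite /coef3 -!subnDA addnC mulrA.
Qed.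

Lemma fil_cauchy a b n :
  (forall i, F i (a i)) -> (forall i, F i (b i)) -> F n (cauchy a b n).
Proof.
move=> Fa Fb; apply: (zmod_set_sum (fil_zmod F n)) => i _.
by rewrite -[X in F X](subnKC (leq_ord i)); exact: filM.
Qed.

Lemma gr_cls_cauchy a b a' b' n :
  (forall i, F i (a i)) -> (forall i, F i (b' i)) ->
  (forall i, gr_cls i (a i) = gr_cls i (a' i)) ->
  (forall i, gr_cls i (b i) = gr_cls i (b' i)) ->
  gr_cls n (cauchy a b n) = gr_cls n (cauchy a' b' n).
Proof.
move=> Fa Fb ea eb; apply/gr_cls_eq; rewrite /cauchy -sumrB.
apply: (zmod_set_sum (fil_pred_zmod n)) => i _.
set j := (n - i)%N; rewrite -[X in fil_pred X](subnKC (leq_ord i)) -/j.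
have -> : a i * b j - a' i * b' j = a i * (b j - b' j) + (a i - a' i) * b' j.
  by rewrite mulrBl mulrBr addrA subrK.
apply: (zmod_setD (fil_pred_zmod _)).
  by apply: fil_predMr => //; exact/gr_cls_eq.
by apply: fil_predMl => //; exact/gr_cls_eq.
Qed.

(* The product of the classes of x in F i and y in F j is the class of x * y
   in degree i + j. *)
Section Mul.
Variables f g : gr.
Definition gr_mul_coef n : gr_amb n := gr_cls n (cauchy (gr_rep f) (gr_rep g) n).
Fact grM_P n : gr_piece (gr_mul_coef n).
Proof.
exists (cauchy (gr_rep f) (gr_rep g) n) => //.
by apply: fil_cauchy => i; exact: (gr_repP _ i).1.
Qed.
Fact grM_fin : exists N, forall n, (N <= n)%N -> gr_mul_coef n = 0.
Proof.
have [N h] := gr_fin f; have [M k] := gr_fin g; exists (N + M)%N => n le.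
apply/gr_cls_eq0; apply: (zmod_set_sum (fil_pred_zmod n)) => i _.
rewrite -[X in fil_pred X](subnKC (leq_ord i)).
have [Ff ef] := gr_repP f i; have [Fg eg] := gr_repP g (n - i).
have [Ni|iN] := leqP N i.
  by apply: fil_predMl => //; apply/gr_cls_eq0; rewrite ef h.
apply: fil_predMr => //; apply/gr_cls_eq0; rewrite eg k //.
rewrite leq_subRL ?leq_ord //; apply: leq_trans le.
by rewrite leq_add2r ltnW.
Qed.
Definition gr_mul : gr := Gr grM_P grM_fin.
End Mul.

Lemma gr_mulE f g a b n :
  (forall i, F i (a i) /\ gr_cls i (a i) = gr_coef f i) ->
  (forall i, F i (b i) /\ gr_cls i (b i) = gr_coef g i) ->
  gr_coef (gr_mul f g) n = gr_cls n (cauchy a b n).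
Proof.
move=> ha hb; apply: gr_cls_cauchy => i.
- exact: (gr_repP f i).1.
- exact: (hb i).1.
- by rewrite (gr_repP f i).2 (ha i).2.
- by rewrite (gr_repP g i).2 (hb i).2.
Qed.

Definition hom_seq (d : nat) (u : U) (n : nat) : U := if n == d then u else 0.

Lemma hom_seqP d u n : F d u -> F n (hom_seq d u n).
Proof.
by rewrite /hom_seq; case: eqP => [->//|_ _]; exact: (fil_zmod F n).1.
Qed.

Section Hom.
Variables (d : nat) (u : U) (Fu : F d u).
Fact grH_P n : gr_piece (gr_cls n (hom_seq d u n)).
Proof. by exists (hom_seq d u n) => //; exact: hom_seqP. Qed.
Fact grH_fin : exists N, forall n, (N <= n)%N -> gr_cls n (hom_seq d u n) = 0.
Proof.
by exists d.+1 => n dn; rewrite /hom_seq gtn_eqF // raddf0.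
Qed.
(* The class of u in the graded piece of degree d. *)
Definition gr_hom : gr := Gr grH_P grH_fin.
End Hom.

Definition gr_one : gr := gr_hom (fil1 F).

Lemma gr_repM f g n : F n (cauchy (gr_rep f) (gr_rep g) n) /\
  gr_cls n (cauchy (gr_rep f) (gr_rep g) n) = gr_coef (gr_mul f g) n.
Proof. by split=> //; apply: fil_cauchy => i; exact: (gr_repP _ i).1. Qed.

Lemma gr_oneP n : F n (hom_seq 0 1 n) /\
  gr_cls n (hom_seq 0 1 n) = gr_coef gr_one n.
Proof. by split=> //; exact/hom_seqP/fil1. Qed.

Lemma gr_repD f g n : F n (gr_rep f n + gr_rep g n) /\
  gr_cls n (gr_rep f n + gr_rep g n) = gr_coef (f + g) n.
Proof.
have [Ff ef] := gr_repP f n; have [Fg eg] := gr_repP g n.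
split; first exact: (zmod_setD (fil_zmod F n) Ff Fg).
by rewrite raddfD /= ef eg.
Qed.

Fact gr_mulA : associative gr_mul.
Proof.
move=> f g h; apply: grP => n.
rewrite (gr_mulE _ (gr_repP f) (gr_repM g h)) cauchyA.
by rewrite (gr_mulE _ (gr_repM f g) (gr_repP h)).
Qed.
Fact gr_mul1 : left_id gr_one gr_mul.
Proof.
move=> f; apply: grP => n; rewrite (gr_mulE _ gr_oneP (gr_repP f)).
rewrite /cauchy big_ord_recl big1 /hom_seq => [|i _]; last by rewrite /= mul0r.
by rewrite mul1r addr0 subn0 (gr_repP f n).2.
Qed.
Fact gr_mulr1 : right_id gr_one gr_mul.
Proof.
move=> f; apply: grP => n; rewrite (gr_mulE _ (gr_repP f) gr_oneP) cauchy_rev.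
rewrite big_ord_recl big1 /hom_seq => [|i _]; last by rewrite /= mulr0.
by rewrite mulr1 addr0 subn0 (gr_repP f n).2.
Qed.
Fact gr_mulDl : left_distributive gr_mul +%R.
Proof.
move=> f g h; apply: grP => n.
rewrite (gr_mulE _ (gr_repD f g) (gr_repP h)) /= -raddfD /=; congr gr_cls.
by rewrite /cauchy -big_split; apply: eq_bigr => i _; rewrite mulrDl.
Qed.
Fact gr_mulDr : right_distributive gr_mul +%R.
Proof.
move=> f g h; apply: grP => n.
rewrite (gr_mulE _ (gr_repP f) (gr_repD g h)) /= -raddfD /=; congr gr_cls.
by rewrite /cauchy -big_split; apply: eq_bigr => i _; rewrite mulrDr.
Qed.
HB.instance Definition _ := GRing.Zmodule_isPzRing.Build gr
  gr_mulA gr_mul1 gr_mulr1 gr_mulDl gr_mulDr.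

End AssociatedGraded.

(* A positive grading, with its projections gproj n onto the component of
   degree n; they are determined by the components. *)
Record grading (T : pzRingType) := Grading {
  gcomp :> nat -> set T;
  gproj : nat -> T -> T;
  gcomp_zmod : forall n, zmod_set (gcomp n);
  gcomp1 : gcomp 0 1;
  gcompM : forall m n x y, gcomp m x -> gcomp n y -> gcomp (m + n) (x * y);
  gproj_zmod : forall n, zmod_morphism (gproj n);
  gproj_in : forall n x, gcomp n (gproj n x);
  gprojE : forall m n x, gcomp m x -> gproj n x = if n == m then x else 0;
  gproj_sum : forall x, exists N, x = \sum_(n < N) gproj n x
}.

HB.instance Definition _ (T : pzRingType) (G : grading T) (n : nat) :=
  GRing.isZmodMorphism.Build T T (gproj G n) (gproj_zmod G n).

Definition connected_grading (S T : pzRingType) (iota : S -> T)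
    (G : grading T) : Prop :=
  injective iota /\ range iota = G 0.

Definition strongly_graded (T : pzRingType) (G : grading T) : Prop :=
  forall n m, mulset (G n) (G m) = G (n + m)%N.

Definition subbimodule (S T : pzRingType) (iota : S -> T) (P : set T) : Prop :=
  zmod_set P /\ forall s x, P x -> P (iota s * x) /\ P (x * iota s).

Section PBW.
Variables (T : pzRingType) (G : grading T).

Definition Tle (n : nat) : set T := zspan (\bigcup_(m in [set m | (m <= n)%N]) G m).

Definition cut (X : set T) (n : nat) : set T := X `&` Tle n.

Lemma Tle_zmod n : zmod_set (Tle n). Proof. exact: zspan_zmod. Qed.

Lemma gcomp_Tle m n : (m <= n)%N -> G m `<=` Tle n.
Proof. by move=> mn x Gx; apply: sub_gen_smallest; exists m. Qed.

Lemma TleS n : Tle n `<=` Tle n.+1.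
Proof.
apply: smallest_sub; first exact: Tle_zmod.
by move=> x [m /= mn]; apply: gcomp_Tle; exact: leqW.
Qed.

Lemma gproj_Tle m n x : Tle n x -> (n < m)%N -> gproj G m x = 0.
Proof.
move=> Tx nm; suff : Tle n `<=` [set y | gproj G m y = 0] by apply.
apply: smallest_sub => [|y [k /= kn Gy] /=]; last first.
  by rewrite (gprojE _ Gy) gtn_eqF // (leq_ltn_trans kn).
by split=> [|y z /= ey ez]; [rewrite /= raddf0|rewrite raddfB /= ey ez subr0].
Qed.

Lemma TleM m n x y : Tle m x -> Tle n y -> Tle (m + n) (x * y).
Proof.
move=> Tx Ty; have z := Tle_zmod (m + n).
suff : Tle m `<=` [set x | forall y, Tle n y -> Tle (m + n) (x * y)].
  by move/(_ x Tx); apply.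
apply: smallest_sub => [|{Tx}x [i /= im] Gx {Ty}y Ty].
  split=> [y' _|a b /= ha hb y' Ty']; first by rewrite mul0r; case: z.
  by rewrite mulrBl; apply: z.2; [exact: ha|exact: hb].
suff : Tle n `<=` [set y | Tle (m + n) (x * y)] by apply.
apply: smallest_sub => [|{Ty}y [j /= jn] Gy /=].
  split=> [|a b /= ha hb]; first by rewrite /= mulr0; case: z.
  by rewrite mulrBr; apply: z.2.
by apply: (gcomp_Tle (leq_add im jn)); exact: gcompM.
Qed.

Lemma gproj_ind (A : set T) : zmod_set A -> (forall n, G n `<=` A) -> forall x, A x.
Proof.
move=> zA GA x; have [N ->] := gproj_sum G x.
by apply: (zmod_set_sum zA) => i _; apply: GA (gproj_in _ _ _).
Qed.

Lemma gprojM n x y : gproj G n (x * y) =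
  cauchy (fun i => gproj G i x) (fun i => gproj G i y) n.
Proof.
pose A := [set x | forall y, gproj G n (x * y) =
  cauchy (fun i => gproj G i x) (fun i => gproj G i y) n].
suff : A x by move/(_ y).
apply: (@gproj_ind A) => [|m {}x Gx {}y].
  split=> [y'|a b ha hb y'].
    by rewrite mul0r raddf0 /cauchy big1 // => i _; rewrite raddf0 mul0r.
  rewrite mulrBl raddfB /= ha hb /cauchy -sumrB; apply: eq_bigr => i _.
  by rewrite raddfB mulrBl.
pose B := [set y | gproj G n (x * y) =
  cauchy (fun i => gproj G i x) (fun i => gproj G i y) n].
suff : B y by [].
apply: (@gproj_ind B) => [|k {}y Gy]; rewrite /B /=.
  split=> [|a b /= ha hb].
    by rewrite /= mulr0 raddf0 /cauchy big1 // => i _; rewrite raddf0 mulr0.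
  rewrite mulrBr raddfB /= ha hb /cauchy -sumrB; apply: eq_bigr => i _.
  by rewrite raddfB mulrBr.
rewrite (gprojE _ (gcompM Gx Gy)) /cauchy.
have [mn|nm] := ltnP m n.+1.
  rewrite (bigD1 (Ordinal mn)) //= big1 ?addr0 => [|i /eqP im].
    rewrite (gprojE _ Gx) eqxx (gprojE _ Gy).
    rewrite -(eqn_add2l m (n - m)) subnKC //.
    by case: eqP; rewrite ?mulr0.
  rewrite (gprojE _ Gx); case: eqP => [e|_]; last by rewrite mul0r.
  by case: im; apply: val_inj.
rewrite ltn_eqF ?ltn_addr // big1 // => i _.
rewrite (gprojE _ Gx) ltn_eqF ?mul0r //.
exact: leq_ltn_trans (leq_ord i) nm.
Qed.

Variable P : set T.

Definition RPn (n : nat) : set T := gproj G n @` cut P n.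
Definition RP : set T := zspan (\bigcup_n RPn n).

Definition A_RP : pzRingType := quot_ring RP.
Definition U_P : pzRingType := quot_ring P.

Definition U_fil_set (n : nat) : set U_P := @qproj T P @` Tle n.

Fact U_fil_zmod n : zmod_set (U_fil_set n).
Proof.
have z := Tle_zmod n; split; first by exists 0; [exact: z.1|rewrite raddf0].
by move=> _ _ [x Tx <-] [y Ty <-]; exists (x - y); [exact: z.2|rewrite raddfB].
Qed.
Fact U_fil_mono n : U_fil_set n `<=` U_fil_set n.+1.
Proof. by move=> _ [x Tx <-]; exists x => //; exact: TleS. Qed.
Fact U_fil1 : U_fil_set 0 1.
Proof. by exists 1; [exact: gcomp_Tle (gcomp1 G)|rewrite rmorph1]. Qed.
Fact U_filM m n x y : U_fil_set m x -> U_fil_set n y -> U_fil_set (m + n) (x * y).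
Proof.
by move=> [a Ta <-] [b Tb <-]; exists (a * b); [exact: TleM|rewrite rmorphM].
Qed.
Definition U_fil : filtration U_P :=
  Filtration U_fil_zmod U_fil_mono U_fil1 U_filM.

Lemma U_fil_proj n x : Tle n x -> U_fil n (@qproj T P x).
Proof. by move=> Tx; exists x. Qed.

Section Phi0.
Variable x : T.
Definition Phi0_coef n : gr_amb U_fil n := gr_cls U_fil n (@qproj T P (gproj G n x)).
Fact Phi0_P n : gr_piece (Phi0_coef n).
Proof.
exists (@qproj T P (gproj G n x)) => //.
by apply: U_fil_proj; apply: gcomp_Tle (leqnn n) _ (gproj_in _ _ _).
Qed.
Fact Phi0_fin : exists N, forall n, (N <= n)%N -> Phi0_coef n = 0.
Proof.
have [N e] := gproj_sum G x; exists N => n Nn.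
rewrite /Phi0_coef; suff -> : gproj G n x = 0 by rewrite !raddf0.
rewrite e raddf_sum big1 // => i _ /=.
by rewrite (gprojE _ (gproj_in G i x)) gtn_eqF // (leq_trans _ Nn).
Qed.
(* The map T -> gr U(P) inducing Phi: the component of degree n of the image
   of x is (p^n x + <P>) + U(P)^{<= n-1}. *)
Definition Phi0 : gr U_fil := Gr Phi0_P Phi0_fin.
End Phi0.

Fact Phi0_zmod : zmod_morphism Phi0.
Proof. by move=> x y; apply: grP => n; rewrite /= /Phi0_coef !raddfB. Qed.
HB.instance Definition _ := GRing.isZmodMorphism.Build T (gr U_fil) Phi0 Phi0_zmod.

Lemma Phi0_rep x n : U_fil n (@qproj T P (gproj G n x)) /\
  gr_cls U_fil n (@qproj T P (gproj G n x)) = gr_coef (Phi0 x) n.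
Proof.
by split=> //; apply: U_fil_proj; apply: gcomp_Tle (leqnn n) _ (gproj_in _ _ _).
Qed.

Lemma Phi0_hom n x (Gx : G n x) :
  Phi0 x = gr_hom (U_fil_proj (gcomp_Tle (leqnn n) Gx)).
Proof.
apply: grP => m; rewrite /= /Phi0_coef /hom_seq (gprojE _ Gx).
by case: eqP; rewrite ?raddf0.
Qed.

Fact Phi0_monoid : monoid_morphism Phi0.
Proof.
split=> [|x y]; last first.
  apply: grP => n; rewrite (gr_mulE _ (Phi0_rep x) (Phi0_rep y)) /=.
  rewrite /Phi0_coef gprojM /cauchy raddf_sum; congr gr_cls.
  by apply: eq_bigr => i _; rewrite -rmorphM.
apply: grP => m; rewrite /= /Phi0_coef /hom_seq (gprojE _ (gcomp1 G)).
by case: eqP; rewrite ?raddf0 ?rmorph1.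
Qed.
HB.instance Definition _ :=
  GRing.isMonoidMorphism.Build T (gr U_fil) Phi0 Phi0_monoid.

Lemma Tle_subproj n x : Tle n x -> gproj G n x = x \/
  exists2 m, n = m.+1 & Tle m (x - gproj G n x).
Proof.
case: n => [|n] Tx; [left|right; exists n => //].
  suff : Tle 0 `<=` [set x | gproj G 0 x = x] by apply.
  apply: smallest_sub => [|y [m /=]].
    by split=> [|a b /= ha hb]; [rewrite /= raddf0|rewrite raddfB /= ha hb].
  by rewrite leqn0 => /eqP -> Gy; rewrite (gprojE _ Gy).
suff : Tle n.+1 `<=` [set x | Tle n (x - gproj G n.+1 x)] by apply.
have z := Tle_zmod n.
apply: smallest_sub => [|y [m /= mn] Gy /=].
  split=> [|a b /= ha hb]; first by rewrite /= raddf0 subr0; case: z.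
  by rewrite raddfB /= opprD addrACA -opprD; apply: z.2.
rewrite (gprojE _ Gy) eq_sym; case: eqP => [_|/eqP ne].
  by rewrite subrr; case: z.
by rewrite subr0; apply: gcomp_Tle Gy; rewrite -ltnS ltn_neqAle ne.
Qed.

Lemma Phi0_RP x : ideal_gen RP x -> Phi0 x = 0.
Proof.
have zK : zmod_set [set x | Phi0 x = 0].
  by split=> [|a b /= ha hb]; rewrite /= ?raddf0 // raddfB /= ha hb subr0.
suff : ideal_gen RP `<=` [set x | Phi0 x = 0] by apply.
apply: smallest_sub.
  by split=> // a y /= ey; rewrite !rmorphM /= ey mulr0 mul0r.
apply: smallest_sub => // _ [n _ [y [Py Ty] <-]] /=.
rewrite (Phi0_hom (gproj_in G n y)); apply: grP => m /=.
rewrite /hom_seq; case: eqP => [->|_]; last by rewrite raddf0.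
have P0 : @qproj T P y = 0.
  by rewrite -(raddf0 (@qproj T P)); apply/qproj_eq; rewrite subr0;
     exact: sub_gen_smallest.
case: (Tle_subproj Ty) => [->|[k -> Tk]]; first by rewrite P0 raddf0.
apply/gr_cls_eq0; rewrite /= -[gproj _ _ _]opprK -[- _]add0r.
exists (- (y - gproj G k.+1 y)); first exact: zmod_setN (Tle_zmod k) _ Tk.
by rewrite opprB raddfB /= P0 subr0 add0r opprK.
Qed.

Definition Phi (a : A_RP) : gr U_fil := Phi0 (qrepr a).

Lemma PhiE x : Phi (@qproj T RP x) = Phi0 x.
Proof.
apply/eqP; rewrite -subr_eq0 -raddfB; apply/eqP/Phi0_RP.
by apply/qproj_eq; rewrite qreprK.
Qed.

Lemma Phi_hom n x (Gx : G n x) : Phi (@qproj T RP x) =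
  gr_hom (U_fil_proj (gcomp_Tle (leqnn n) Gx)).
Proof. by rewrite PhiE (Phi0_hom Gx). Qed.

Fact Phi_zmod : zmod_morphism Phi.
Proof.
move=> a b; rewrite -[a]qreprK -[b]qreprK -raddfB.
by rewrite !PhiE raddfB.
Qed.
HB.instance Definition _ := GRing.isZmodMorphism.Build A_RP (gr U_fil) Phi Phi_zmod.

Fact Phi_monoid : monoid_morphism Phi.
Proof.
split=> [|a b]; first by rewrite -(rmorph1 (@qproj T RP)) PhiE rmorph1.
rewrite -[a]qreprK -[b]qreprK -rmorphM.
by rewrite !PhiE rmorphM.
Qed.
HB.instance Definition _ := GRing.isMonoidMorphism.Build A_RP (gr U_fil) Phi Phi_monoid.

(* Phi is a graded ring morphism (Phi_hom), so it is an isomorphism as soon as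
   it is bijective. *)
Definition PBW_type : Prop := bijective Phi.

Definition Pfil (n : nat) : set T :=
  zspan (\bigcup_(ijk in [set ijk : nat * nat * nat |
                           (ijk.1.1 + ijk.1.2 + ijk.2)%N = n])
    mulset (mulset (Tle ijk.1.1) (cut P ijk.1.2)) (Tle ijk.2)).

Definition jacobian (Q : nat -> set T) : Prop :=
  forall n, Q n.+1 `&` Tle n `<=` Q n.

End PBW.

(* Main.v *)
Require Import Defs.
From HB Require Import structures.
From mathcomp Require Import all_boot all_algebra.
From mathcomp Require Import boolp classical_sets.

Set Implicit Arguments.
Unset Strict Implicit.
Unset Printing Implicit Defensive.

Import GRing.Theory.
Local Open Scope ring_scope.
Local Open Scope classical_set_scope.

(** If [x] lies in <P> and in T^{<= n}, its leading form p^n x is killed by the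
    map T -> gr U(P). When Phi is injective, p^n x then lies in <R_P>, whose
    component of degree n is p^n(P_n); so x agrees in degree n with an element of
    P_n, and induction on n gives x \in P_n. Conversely, if <P> meets T^{<= n} in
    P_n, an element of T^n killed by T -> gr U(P) is the leading form of an
    element of P_n, hence lies in <R_P>. *)

Lemma qproj_eq0 (R : pzRingType) (X : set R) x :
  @qproj R X x = 0 <-> ideal_gen X x.
Proof. by rewrite -(raddf0 (@qproj R X)) qproj_eq subr0. Qed.

Lemma zmod_set_preim (V W : zmodType) (f : {additive V -> W}) (A : set W) :
  zmod_set A -> zmod_set (f @^-1` A).
Proof.
move=> zA; split=> [|x y /= fx fy]; first by rewrite /= raddf0; exact: zA.1.
by rewrite /= raddfB; exact: zA.2.
Qed.

Lemma zmod_set_im (V W : zmodType) (f : {additive V -> W}) (A : set V) :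
  zmod_set A -> zmod_set (f @` A).
Proof.
move=> zA; split; first by exists 0; [exact: zA.1|rewrite raddf0].
by move=> _ _ [x Ax <-] [y Ay <-]; exists (x - y); [exact: zA.2|rewrite raddfB].
Qed.

(** * The degree filtration of [T] and its leading forms *)

Section Tle.
Variables (T : pzRingType) (G : grading T).

Lemma Tle_le m n : (m <= n)%N -> Tle G m `<=` Tle G n.
Proof.
move=> /subnK <-; elim: (n - m)%N => // k IH x /IH; rewrite addSn; exact: TleS.
Qed.

Lemma Tle_ex x : exists n, Tle G n x.
Proof.
have [N ->] := gproj_sum G x; exists N.
apply: (zmod_set_sum (Tle_zmod G N)) => i _.
by apply: (gcomp_Tle (ltnW (ltn_ord i))); exact: gproj_in.
Qed.

Lemma Tle1 : Tle G 0 1.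
Proof. exact: gcomp_Tle (leqnn 0) _ (gcomp1 G). Qed.

Lemma gproj_Tle_in n x : Tle G n (gproj G n x).
Proof. by apply: (gcomp_Tle (leqnn n)); exact: gproj_in. Qed.

Lemma gproj_id m n x : gproj G m (gproj G n x) = if m == n then gproj G n x else 0.
Proof. exact: gprojE (gproj_in _ _ _). Qed.

(** In the convolution formula for the component of degree [m + n], a term of index [i > m] dies
    because of [x], and one of index [i < m] because of [y]. *)
Lemma gprojM_top m n x y : Tle G m x -> Tle G n y ->
  gproj G (m + n) (x * y) = gproj G m x * gproj G n y.
Proof.
move=> Tx Ty; have lt : (m < (m + n).+1)%N by rewrite ltnS leq_addr.
rewrite gprojM /cauchy (bigD1 (Ordinal lt)) //= addKn big1 ?addr0 //.
move=> i /eqP im; have [lt_im|lt_mi|e] := ltngtP i m; last first.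
- by case: im; apply: val_inj.
- by rewrite (gproj_Tle Tx) ?mul0r.
- by rewrite (gproj_Tle Ty) ?mulr0 // ltn_subRL ltn_add2r.
Qed.

End Tle.

(** * The filtration P_n of the ideal <P> *)

Section Pfil.
Variables (T : pzRingType) (G : grading T) (P : set T).

Local Notation Pf := (Pfil G P).

Lemma Pfil_zmod n : zmod_set (Pf n). Proof. exact: zspan_zmod. Qed.

Lemma Pfil_mul3 i j k a b c : Tle G i a -> cut G P j b -> Tle G k c ->
  Pf (i + j + k) (a * b * c).
Proof.
move=> Ta Pb Tc; apply: sub_gen_smallest; exists (i, j, k) => //=.
apply: sub_gen_smallest; exists (a * b); last by exists c.
by apply: sub_gen_smallest; exists a => //; exists b.
Qed.

(** Elimination principle for [Pfil]: it peels off the three nested spans once and for all. *)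
Lemma Pfil_sub (A : set T) n : zmod_set A ->
  (forall i j k a b c, (i + j + k)%N = n ->
     Tle G i a -> cut G P j b -> Tle G k c -> A (a * b * c)) ->
  Pf n `<=` A.
Proof.
move=> zA h; apply: smallest_sub => // x [[[i j] k] /= e].
move: x; apply: smallest_sub => // _ [y hy [c Tc <-]].
move: y hy; suff : mulset (Tle G i) (cut G P j) `<=` [set y | A (y * c)] by [].
apply: smallest_sub => [|_ [a Ta [b Pb <-]]]; last exact: (h _ _ _ _ _ _ e Ta Pb Tc).
split=> [|u v /= hu hv]; first by rewrite /= mul0r; exact: zA.1.
by rewrite /= mulrBl; exact: zA.2.
Qed.

Lemma PfilMl m n a x : Tle G m a -> Pf n x -> Pf (m + n) (a * x).
Proof.
move=> Ta; move: x; suff : Pf n `<=` [set x | Pf (m + n) (a * x)] by [].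
have z := Pfil_zmod (m + n).
apply: Pfil_sub => [|i j k b p c <- Tb Pp Tc /=].
  split=> [|u v /= hu hv]; first by rewrite /= mulr0; exact: z.1.
  by rewrite /= mulrBr; exact: z.2.
by rewrite !mulrA !addnA; apply: Pfil_mul3 => //; exact: TleM.
Qed.

Lemma PfilMr m n a x : Tle G m a -> Pf n x -> Pf (n + m) (x * a).
Proof.
move=> Ta; move: x; suff : Pf n `<=` [set x | Pf (n + m) (x * a)] by [].
have z := Pfil_zmod (n + m).
apply: Pfil_sub => [|i j k b p c <- Tb Pp Tc /=].
  split=> [|u v /= hu hv]; first by rewrite /= mul0r; exact: z.1.
  by rewrite /= mulrBl; exact: z.2.
by rewrite -mulrA -addnA; apply: Pfil_mul3 => //; exact: TleM.
Qed.

Lemma Pfil_le m n : (m <= n)%N -> Pf m `<=` Pf n.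
Proof.
(* The gap [n - m] is filled by the factor 1, seen in T^{<= n-m}. *)
move=> /subnK <- x Px; rewrite -[x]mul1r; apply: PfilMl => //.
by apply: (Tle_le (leq0n _)); exact: Tle1.
Qed.

Lemma cut_Pfil n : cut G P n `<=` Pf n.
Proof.
move=> x Px; have := Pfil_mul3 (@Tle1 _ G) Px (@Tle1 _ G).
by rewrite mul1r mulr1 addn0.
Qed.

Lemma Pfil_Tle n : Pf n `<=` Tle G n.
Proof.
apply: Pfil_sub => [|i j k a b c <- Ta [_ Tb] Tc]; first exact: Tle_zmod.
by do 2!apply: TleM => //.
Qed.

Lemma Pfil_ideal n : Pf n `<=` ideal_gen P.
Proof.
have [zI mI] := ideal_gen_ideal P.
apply: Pfil_sub => // i j k a b c _ _ [Pb _] _.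
by apply: (mI _ _ _).2; apply: (mI _ _ _).1; exact: sub_gen_smallest.
Qed.

(** The union of the P_n is an ideal, being the union of an increasing chain that absorbs factors up
    to a shift of index; it contains P because every element of [T] has bounded degree. *)
Lemma ideal_gen_Pfil x : ideal_gen P x -> exists n, Pf n x.
Proof.
move: x; suff : ideal_gen P `<=` [set x | exists n, Pf n x] by [].
apply: smallest_sub => [|x Px]; last first.
  by have [n Tx] := Tle_ex G x; exists n; exact: cut_Pfil.
split; first split=> [|x y [m Px] [n Py]].
- by exists 0; exact: (Pfil_zmod 0).1.
- exists (maxn m n); apply: (Pfil_zmod _).2.
    by apply: (Pfil_le (leq_maxl _ _)); exact: Px.
  by apply: (Pfil_le (leq_maxr _ _)); exact: Py.
move=> a x [n Px]; have [m Ta] := Tle_ex G a; split.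
  by exists (m + n)%N; exact: PfilMl.
by exists (n + m)%N; exact: PfilMr.
Qed.

(** * The degree n component of <R_P> is p^n(P_n) *)

Lemma gproj_Pfil_RP n x : Pf n x -> ideal_gen (RP G P) (gproj G n x).
Proof.
move: x; have [zI mI] := ideal_gen_ideal (RP G P).
apply: Pfil_sub; first exact: (zmod_set_preim (gproj G n) zI).
move=> i j k a b c <- Ta Pb Tc; rewrite /=.
rewrite gprojM_top //; last by apply: TleM => //; exact: Pb.2.
rewrite gprojM_top //; last exact: Pb.2.
apply: (mI _ _ _).2; apply: (mI _ _ _).1; apply: sub_gen_smallest.
by apply: sub_gen_smallest; exists j => //; exists b.
Qed.

Lemma gproj_PfilMl m n a x : Tle G m a -> (gproj G n @` Pf n) x ->
  (gproj G (m + n) @` Pf (m + n)) (gproj G m a * x).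
Proof.
move=> Ta [z Pz <-]; exists (a * z); first exact: PfilMl.
by rewrite gprojM_top //; exact: Pfil_Tle.
Qed.

Lemma gproj_PfilMr m n a x : Tle G m a -> (gproj G n @` Pf n) x ->
  (gproj G (n + m) @` Pf (n + m)) (x * gproj G m a).
Proof.
move=> Ta [z Pz <-]; exists (z * a); first exact: PfilMr.
by rewrite gprojM_top //; exact: Pfil_Tle.
Qed.

(** The elements whose components all lie in the respective p^n(P_n) form an ideal [J], by the
    convolution formula; it contains each R_P^m since P^{<= m} lies in P_m. *)
Lemma ideal_RP_gproj n x : ideal_gen (RP G P) x -> (gproj G n @` Pf n) (gproj G n x).
Proof.
have zp m : zmod_set (gproj G m @` Pf m) := zmod_set_im _ (Pfil_zmod m).
pose J := [set x | forall n, (gproj G n @` Pf n) (gproj G n x)].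
have zJ : zmod_set J.
  split=> [m|y z Jy Jz m]; first by rewrite raddf0; exact: (zp m).1.
  by rewrite raddfB; exact: (zp m).2.
suff : ideal_gen (RP G P) `<=` J by move=> h /h; exact.
apply: smallest_sub; first split=> // a y Jy.
  split=> m; rewrite gprojM; apply: (zmod_set_sum (zp m)) => i _.
    have := gproj_PfilMl (@gproj_Tle_in _ G i a) (Jy (m - i)%N).
    by rewrite gproj_id eqxx subnKC // leq_ord.
  have := gproj_PfilMr (@gproj_Tle_in _ G (m - i) a) (Jy i).
  by rewrite gproj_id eqxx subnKC // leq_ord.
apply: smallest_sub => // _ [m _ [y Py <-]] k; rewrite gproj_id.
case: eqP => [->|_]; first by exists y => //; exact: cut_Pfil.
exact: (zp k).1.
Qed.

(** * Kernel and image of Phi *)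

Lemma fil_pred_qproj n x : fil_pred (U_fil G P) n (@qproj T P x) ->
  exists y, [/\ ideal_gen P (x - y), Tle G n y & gproj G n y = 0].
Proof.
(* In degree 0 the preceding term of the filtration is zero, so [x] is in <P> and [y] is 0. *)
case: n => [/qproj_eq0 Ix|n [y Ty e]].
  by exists 0; rewrite subr0 raddf0; split=> //; exact: (Tle_zmod G 0).1.
by exists y; split; [exact/qproj_eq|exact: TleS|exact: gproj_Tle Ty _].
Qed.

Lemma gr_cls_gproj n x : Tle G n x ->
  gr_cls (U_fil G P) n (@qproj T P (gproj G n x)) =
  gr_cls (U_fil G P) n (@qproj T P x).
Proof.
move=> /Tle_subproj [->//|[k -> Tk]]; apply/esym/gr_cls_eq.
by rewrite -raddfB; exact: U_fil_proj.
Qed.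

Lemma Phi0_gproj n x : ideal_gen P x -> Tle G n x ->
  Phi0 G P (gproj G n x) = 0.
Proof.
move=> /qproj_eq0 x0 Tx; apply: grP => m; rewrite /= /Phi0_coef gproj_id.
by case: eqP => [->|_]; [rewrite gr_cls_gproj // x0|]; rewrite !raddf0.
Qed.

Lemma Phi_inj_Pfil : injective (@Phi T G P) ->
  forall n, ideal_gen P `&` Tle G n `<=` Pf n.
Proof.
move=> injPhi; have [zI _] := ideal_gen_ideal P.
have lead n x : ideal_gen P x -> Tle G n x ->
    exists2 y, Pf n y & gproj G n (x - y) = 0.
  move=> Ix Tx; have : ideal_gen (RP G P) (gproj G n x).
    by apply/qproj_eq0/injPhi; rewrite PhiE Phi0_gproj // raddf0.
  move=> /(ideal_RP_gproj n) [y Py]; rewrite gproj_id eqxx => e.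
  by exists y => //; rewrite raddfB /= e subrr.
elim=> [|n IH] x [Ix Tx]; have [y Py e] := lead _ x Ix Tx.
  (* In degree 0 the element [x - y] is its own component, so [x = y]. *)
  have [h|[]//] := Tle_subproj ((Tle_zmod G 0).2 _ _ Tx (Pfil_Tle Py)).
  by move: h; rewrite e => /esym/eqP; rewrite subr_eq0 => /eqP ->.
(* The difference [x - y] stays in <P> and has lost its component of degree [n.+1], so the induction
   hypothesis applies to it. *)
rewrite -[x](subrK y); apply: (zmod_setD (Pfil_zmod _)) => //.
apply: (Pfil_le (leqnSn n)); apply: IH; split.
  exact: zI.2 Ix (Pfil_ideal Py).
have Txy := (Tle_zmod G n.+1).2 _ _ Tx (Pfil_Tle Py).
have [h|[k [<-]]] := Tle_subproj Txy; last by rewrite e subr0.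
by rewrite -h e; exact: (Tle_zmod G n).1.
Qed.

Lemma Phi_inj : (forall n, ideal_gen P `&` Tle G n `<=` Pf n) ->
  injective (@Phi T G P).
Proof.
move=> hP; have [zI _] := ideal_gen_ideal P.
suff ker x : Phi0 G P x = 0 -> ideal_gen (RP G P) x.
  apply: raddf_inj => a; rewrite -[a]qreprK /= PhiE => /ker h; exact/qproj_eq0.
move=> x0; have [N ->] := gproj_sum G x.
apply: (zmod_set_sum (ideal_gen_ideal _).1) => n _.
have /gr_cls_eq0/fil_pred_qproj [y [Iy Ty y0]] : Phi0_coef G P x n = 0.
  by rewrite -[LHS]/(gr_coef (Phi0 G P x) n) x0.
(* Subtracting [y] leaves the component of degree [n] unchanged and moves the element into <P>,
   hence into P_n. *)
have -> : gproj G n x = gproj G n (gproj G n x - y).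
  by rewrite raddfB /= y0 subr0 gproj_id eqxx.
apply: gproj_Pfil_RP; apply: hP; split=> //.
exact: (Tle_zmod G n).2 (@gproj_Tle_in _ G n x) Ty.
Qed.

(** Each component of [f] lifts to some T^{<= n}, and the finite sum of the leading forms of the
    lifts is a preimage. *)
Lemma Phi_surj f : exists a, Phi (G := G) (P := P) a = f.
Proof.
have [N fN] := gr_fin f.
have rep n : exists y, Tle G n y /\ gr_cls (U_fil G P) n (@qproj T P y) = gr_coef f n.
  by have [_ [y Ty <-] <-] := gr_coefP f n; exists y.
have [y yP] := choice rep.
exists (@qproj T (RP G P) (\sum_(n < N) gproj G n (y n))); rewrite PhiE.
apply: grP => n; rewrite /= /Phi0_coef raddf_sum /=.
have [Nn|nN] := leqP N n.
  rewrite fN // big1 ?raddf0 // => i _.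
  by rewrite gproj_id gtn_eqF // (leq_trans (ltn_ord i)).
rewrite (bigD1 (Ordinal nN)) //= big1 => [|i /eqP ne].
  by rewrite gproj_id eqxx addr0 gr_cls_gproj ?(yP n).2 //; exact: (yP n).1.
by rewrite gproj_id; case: eqP => // e; case: ne; apply: val_inj.
Qed.

(** As Phi is always surjective, only its injectivity is at stake. *)
Lemma PBW_typeP : PBW_type G P <-> forall n, ideal_gen P `&` Tle G n `<=` Pf n.
Proof.
split=> [/bij_inj|/Phi_inj injPhi]; first exact: Phi_inj_Pfil.
have [g gK] := choice Phi_surj.
by exists g => // a; apply: injPhi; rewrite gK.
Qed.

Lemma jacobian_sub m n : jacobian G Pf -> Pf m `&` Tle G n `<=` Pf n.
Proof.
move=> jac; have [mn x [Px _]|/ltnW/subnK <-] := leqP m n.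
  exact: Pfil_le Px.
(* The index descends from [m] to [n] one Jacobi step at a time; [x] stays in every T^{<= k+n}. *)
elim: (m - n)%N => [|k IH] x [Px Tx] //.
apply: IH; split=> //; apply: jac; split=> //.
by apply: (Tle_le (leq_addl _ _)); exact: Tx.
Qed.

End Pfil.

Theorem theorem2p12 (S T : pzRingType) (iota : {rmorphism S -> T})
    (G : grading T) (P : set T) :
  connected_grading iota G ->
  strongly_graded G ->
  subbimodule iota P ->
  [<-> PBW_type G P;
       jacobian G (Pfil G P);
       forall n m : nat, (n < m)%N -> Pfil G P m `&` Tle G n `<=` Pfil G P n;
       forall n : nat, ideal_gen P `&` Tle G n = Pfil G P n].
Proof.
move=> _ _ _; tfae.
- move=> /PBW_typeP hP n x [Px Tx]; apply: hP; split=> //.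
  exact: Pfil_ideal Px.
- by move=> jac n m _; exact: jacobian_sub.
- move=> h n; apply/seteqP; split=> [x [] | x Px].
    (* An element of <P> lies in some P_m; assertion (3) is needed only for [m > n], monotonicity
       covering the other case. *)
    move=> /(ideal_gen_Pfil G) [m Px] Tx.
    by have [mn|nm] := leqP m n; [exact: Pfil_le Px|exact: h nm _ _].
  by split; [exact: Pfil_ideal Px|exact: Pfil_Tle Px].
- by move=> h; apply/PBW_typeP => n; rewrite h.
Qed.
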